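(* Let $m\ge2$, $k\ge1$, $D=\{1,-1,\dots,m,-m\}$, and let $\Gamma$ be a finite vertex-transitive graph with vertex set $D\times[k]$ such that $G=\mathrm{Aut}(\Gamma)$ satisfies $X^k\le G\le Y\wr\mathrm{Sym}(k)$ with $X=\{1\}\times\mathrm{Sym}(m)$ and $Y=\langle\tau\rangle\times\mathrm{Sym}(m)$, and such that the pointwise stabiliser in $G$ of $V\Gamma\setminus(D\times\{1\})$ equals $X$ (acting on $D\times\{1\}$). For $1\le j\le k$ let $D_j=D\times\{j\}$; for $\varepsilon\in\{1,-1\}$ let $A_{\varepsilon j}=\{(\varepsilon i,j):1\le i\le m\}$ (these are the orbits of $X^k$). Let $\Sigma$ be the quotient graph $\Gamma/X^k$ with vertex set $\{A_{\pm j}:1\le j\le k\}$, and $\mathcal P=\{\{A_j,A_{-j}\}:1\le j\le k\}$. Then: (1) for all $j_1,j_2$, $\Gamma[D_{j_1}]\cong\Gamma[D_{j_2}]$, and $\Gamma[D_{j_1}]$ is isomorphic to $mK_2$, $K_m\square K_2$, $\overline{mK_2}$ or $\overline{K_m\square K_2}$; (2) $\Gamma\cong\mathrm{Inf}(\Sigma,\mathcal P,m,\lambda,\kappa)$ where $(\lambda,\kappa)=(1,0)$ if $\Gamma[D_1]\cong mK_2$, $(1,1)$ if $\Gamma[D_1]\cong K_m\square K_2$, $(0,1)$ if $\Gamma[D_1]\cong\overline{mK_2}$, and $(0,0)$ if $\Gamma[D_1]\cong\overline{K_m\square K_2}$; (3) for no $j$ is the transposition $(A_j\ A_{-j})$ an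 automorphism of $\Sigma$ (i.e. $\Sigma$ admits no transposition preserving $\mathcal P$).
   Context: $[k]=\{1,\dots,k\}$. $\mathrm{Sym}(m)$ acts on $D$ by $\varepsilon i\mapsto\varepsilon\sigma(i)$, giving $X=\{1\}\times\mathrm{Sym}(m)$; $\tau:x\mapsto -x$; $Y=\langle\tau\rangle\times\mathrm{Sym}(m)$ is generated by $\tau$ and $X$. $Y\wr\mathrm{Sym}(k)$ acts on $D\times[k]$ by $(\delta,j)^{((y_1,\dots,y_k),h)}=(\delta^{y_j},j^h)$, and $X^k=\{((x_1,\dots,x_k),1):x_j\in X\}$. $\Gamma[S]$ is the induced subgraph on $S$. The quotient $\Gamma/X^k$ has the $X^k$-orbits as vertices, two distinct orbits adjacent iff some vertex of one is adjacent in $\Gamma$ to some vertex of the other. $mK_2$ is a perfect matching on $2m$ vertices, $\square$ Cartesian product, overline complement. For a graph $\Sigma$, a partition $\mathcal P$ of $V\Sigma$ into $2$-sets, $m\ge2$ and $\lambda,\kappa\in\mathbb Z_2$, $\mathrm{Inf}(\Sigma,\mathcal P,m,\lambda,\kappa)$ has vertex set $V\Sigma\times\{1,\dots,m\}$ with $(\alpha,i)\sim(\beta,j)$ iff: $\{\alpha,\beta\}\notin\mathcal P$ and $\alpha\sim\beta$ in $\Sigma$; or $\{\alpha,\beta\}\in\mathcal P$, $\lambda=1$, $i=j$; or $\{\alpha,\beta\}\in\mathcal P$, $\lambda=0$, $i\ne j$; or $\alpha=\beta$ (with $i\neq j$) and $\kappa=1$. *)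

(* Defs.v *)
From mathcomp Require Import all_boot all_order all_algebra all_fingroup.

Set Implicit Arguments.
Unset Strict Implicit.
Unset Printing Implicit Defensive.

Local Open Scope group_scope.

(* A graph on a finType T is a relation e : rel T that is symmetric and      *)
(* irreflexive.                                                              *)

Definition graph_iso (T U : finType) (e : rel T) (f : rel U) : Prop :=
  exists2 phi : T -> U, bijective phi & {mono phi : x y / e x y >-> f x y}.

Definition graph_aut (T : finType) (e : rel T) : {set {perm T}} :=
  [set s : {perm T} | [forall x, forall y, e (s x) (s y) == e x y]].

Definition vertex_transitive (T : finType) (e : rel T) : bool :=
  [transitive graph_aut e, on [set: T] | 'P].

Definition induced (T : finType) (e : rel T) (S : {set T}) :
  rel {x : T | x \in S} := fun x y => e (val x) (val y).

Definition compl_graph (T : finType) (e : rel T) : rel T :=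
  fun x y => (x != y) && ~~ e x y.

Definition complete_graph n : rel 'I_n := fun i j => i != j.

Definition cart_prod (T U : finType) (e : rel T) (f : rel U) : rel (T * U) :=
  fun x y => ((x.1 == y.1) && f x.2 y.2) || ((x.2 == y.2) && e x.1 y.1).

(* m K_2, as m disjoint copies of K_2 *)
Definition matching m : rel ('I_m * 'I_2) :=
  fun x y => (x.1 == y.1) && complete_graph x.2 y.2.

Definition prism m : rel ('I_m * 'I_2) :=
  cart_prod (@complete_graph m) (@complete_graph 2).

Definition orbits (T : finType) (H : {set {perm T}}) : {set {set T}} :=
  [set orbit 'P H x | x in [set: T]].

Definition quotient_vertex (T : finType) (H : {set {perm T}}) : finType :=
  {A : {set T} | A \in orbits H}.

Definition quotient_graph (T : finType) (e : rel T) (H : {set {perm T}}) :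
  rel (quotient_vertex H) :=
  fun A B => (A != B) && [exists x in val A, exists y in val B, e x y].

(* Meant for P a partition of T into sets of cardinality 2. *)
Definition inf_graph (T : finType) (e : rel T) (P : {set {set T}}) (m : nat)
  (lam kap : 'Z_2) : rel (T * 'I_m) :=
  fun x y =>
    let: (a, i) := x in let: (b, j) := y in
    [|| ([set a; b] \notin P) && e a b,
        [&& [set a; b] \in P, lam == 1%R & i == j],
        [&& [set a; b] \in P, lam == 0%R & i != j]
      | [&& a == b, i != j & kap == 1%R]].

(* D = {1, -1, ..., m, -m}: the point (eps, i) stands for i+1 if eps is true *)
(* and for -(i+1) if eps is false.                                           *)
Notation signed m := (bool * 'I_m)%type.

Definition sym_fun m (s : 'S_m) (x : signed m) : signed m := (x.1, s x.2).

Lemma sym_fun_inj m (s : 'S_m) : injective (sym_fun s).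
Proof. by move=> [a i] [b j] [-> /perm_inj ->]. Qed.

Definition sym_perm m (s : 'S_m) : {perm signed m} := perm (@sym_fun_inj m s).

Definition neg_fun m (x : signed m) : signed m := (~~ x.1, x.2).

Lemma neg_fun_inj m : injective (@neg_fun m).
Proof. by move=> [a i] [b j] [/negb_inj -> ->]. Qed.

Definition tau m : {perm signed m} := perm (@neg_fun_inj m).

Definition Xgrp m : {set {perm signed m}} := [set sym_perm s | s : 'S_m].

Definition Ygrp m : {set {perm signed m}} := <<tau m |: Xgrp m>>.

Section Wreath.

Variables (T : finType) (k : nat).

Definition wr_fun (y : {ffun 'I_k -> {perm T}}) (h : 'S_k) (p : T * 'I_k) :
  T * 'I_k := (y p.2 p.1, h p.2).

Lemma wr_fun_inj y h : injective (wr_fun y h).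
Proof.
move=> [a i] [b j] [/= + /perm_inj eq_ij]; rewrite -eq_ij.
by move=> /perm_inj ->.
Qed.

Definition wr_perm y h : {perm T * 'I_k} := perm (@wr_fun_inj y h).

Definition wreath (Y : {set {perm T}}) : {set {perm T * 'I_k}} :=
  [set wr_perm y h | y in ffun_on Y, h in [set: 'S_k]].

Definition base_power (X : {set {perm T}}) : {set {perm T * 'I_k}} :=
  [set wr_perm x 1 | x in ffun_on X].

(* X acting on T * {j} and trivially elsewhere *)
Definition base_factor (X : {set {perm T}}) (j : 'I_k) :
  {set {perm T * 'I_k}} :=
  [set wr_perm [ffun i => if i == j then x else 1] 1 | x in X].

End Wreath.

Definition Xk m k : {set {perm signed m * 'I_k}} := base_power k (Xgrp m).

Definition Dset m k (j : 'I_k) : {set signed m * 'I_k} :=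
  [set p | p.2 == j].

(* A_j is Aset m true j and A_{-j} is Aset m false j. *)
Definition Aset m k (eps : bool) (j : 'I_k) : {set signed m * 'I_k} :=
  [set ((eps, i), j) | i : 'I_m].

Lemma Xk_orbit m k eps (i : 'I_m) (j : 'I_k) :
  orbit 'P (Xk m k) ((eps, i), j) = Aset m eps j.
Proof.
apply/setP=> p; apply/orbitP/imsetP=> [[g] | [i' _ ->]].
  case/imsetP=> y /ffun_onP Xy -> <-; have /imsetP[s _ ys] := Xy j.
  by exists (s i) => //; rewrite /= apermE permE /wr_fun /= perm1 ys permE.
exists (wr_perm [ffun _ => sym_perm (tperm i i')] 1).
  apply: imset_f; apply/ffun_onP=> j'; rewrite ffunE; exact: imset_f.
by rewrite /= apermE permE /wr_fun /= perm1 ffunE permE /sym_fun /= tpermL.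
Qed.

Lemma Aset_orbit m k (hm : 1 < m) eps (j : 'I_k) :
  Aset m eps j \in orbits (Xk m k).
Proof.
by rewrite -(Xk_orbit eps (Ordinal (ltnW hm))); apply: imset_f; rewrite inE.
Qed.

Lemma orbits_Xk m k (hm : 1 < m) :
  orbits (Xk m k) = [set Aset m ej.1 ej.2 | ej : bool * 'I_k].
Proof.
apply/setP=> A; apply/imsetP/imsetP=> [[[[e i] j] _ ->] | [[e j] _ ->]].
  by exists (e, j); rewrite ?Xk_orbit.
exists ((e, Ordinal (ltnW hm)), j); rewrite ?inE // Xk_orbit //.
Qed.

Definition Avertex m k (hm : 1 < m) (eps : bool) (j : 'I_k) :
  quotient_vertex (Xk m k) := exist _ (Aset m eps j) (Aset_orbit hm eps j).

Definition Ppart m k (hm : 1 < m) : {set {set quotient_vertex (Xk m k)}} :=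
  [set [set Avertex hm true j; Avertex hm false j] | j : 'I_k].

Lemma Avertex_inj m k (hm : 1 < m) eps1 eps2 (j1 j2 : 'I_k) :
  Avertex hm eps1 j1 = Avertex hm eps2 j2 -> (eps1, j1) = (eps2, j2).
Proof.
move=> /(congr1 val) /= /setP /(_ ((eps1, Ordinal (ltnW hm)), j1)).
rewrite imset_f //; case/esym/imsetP=> i _; case=> -> _ -> //.
Qed.

Lemma Ppart_partition m k (hm : 1 < m) :
  partition (Ppart k hm) [set: quotient_vertex (Xk m k)] /\
  (forall p, p \in Ppart k hm -> #|p| = 2).
Proof.
split; last first.
  move=> p /imsetP[j _ ->]; rewrite cards2.
  by case: eqP => // /Avertex_inj.
apply/and3P; split.
- apply/eqP/setP=> A; rewrite inE; apply/bigcupP.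
  have /imsetP[[eps j] _ /= eqA] :
    val A \in [set Aset m ej.1 ej.2 | ej : bool * 'I_k].
    by rewrite -(orbits_Xk k hm); exact: valP.
  exists [set Avertex hm true j; Avertex hm false j]; first exact: imset_f.
  have -> : A = Avertex hm eps j by exact: val_inj.
  by rewrite !inE; case: (eps); rewrite eqxx ?orbT.
- apply/trivIsetP=> _ _ /imsetP[j1 _ ->] /imsetP[j2 _ ->] neq.
  rewrite -setI_eq0; apply/eqP/setP=> A; rewrite !inE; apply/negbTE.
  apply: contraNN neq => /andP[].
  by case/orP=> /eqP-> /orP[] /eqP/Avertex_inj [] // ->.
- by apply/imsetP=> -[j _ /setP /(_ (Avertex hm true j))]; rewrite !inE eqxx.
Qed.

(* Main.v *)
Require Import Defs.
From mathcomp Require Import all_boot all_order all_algebra all_fingroup.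
From mathcomp Require Import zify.

Set Implicit Arguments.
Unset Strict Implicit.
Unset Printing Implicit Defensive.

(* Since X^k acts independently and 2-transitively on the sets A_j, edges
   between distinct blocks D_j are all or nothing on each A x A', each A_j
   is complete or empty, and A_j, A_{-j} are joined by a matching, its
   bipartite complement, everything or nothing. In the last two cases Sym(m)
   acting on A_1 alone would fix the rest of the graph, so the stabiliser
   would exceed X; and vertex-transitivity makes all blocks and both signs
   look alike. A transposition (A_j A_{-j}) of the quotient lifts to the
   sign change on D_j, whose conjugate on D_1 would again lie in the
   stabiliser but not in X. *)

(** * Graph isomorphisms and automorphism groups *)

Lemma graph_iso_sym (T U : finType) (e : rel T) (f : rel U) :
  graph_iso e f -> graph_iso f e.
Proof.
case=> phi [psi phiK psiK] phi_mono; exists psi; first by exists phi.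
by move=> x y; rewrite -phi_mono !psiK.
Qed.

Lemma graph_iso_trans (T U V : finType) (e : rel T) (f : rel U) (g : rel V) :
  graph_iso e f -> graph_iso f g -> graph_iso e g.
Proof.
case=> phi phi_bij phi_mono [psi psi_bij psi_mono].
exists (psi \o phi); first exact: bij_comp.
by move=> x y /=; rewrite psi_mono phi_mono.
Qed.

Lemma graph_iso_degree (T U : finType) (e : rel T) (f : rel U) (x : T) :
  graph_iso e f -> exists y : U, #|e x| = #|f y|.
Proof.
case=> phi phi_bij phi_mono; exists (phi x).
rewrite -(card_image (bij_inj phi_bij)); apply: eq_card => y.
case: phi_bij => psi phiK psiK; rewrite -[y]psiK.
by rewrite (mem_image (can_inj phiK)) -!topredE /= phi_mono.
Qed.

Lemma graph_autP (T : finType) (e : rel T) (s : {perm T}) :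
  reflect {mono s : x y / e x y} (s \in graph_aut e).
Proof.
rewrite inE; apply: (iffP forallP) => [Hs x y|Hs x].
  by move/forallP: (Hs x) => /(_ y)/eqP.
by apply/forallP=> y; rewrite Hs.
Qed.

Lemma graph_aut_group_set (T : finType) (e : rel T) : group_set (graph_aut e).
Proof.
apply/group_setP; split=> [|s t /graph_autP Hs /graph_autP Ht].
  by apply/graph_autP=> x y; rewrite !perm1.
by apply/graph_autP=> x y; rewrite !permM Ht Hs.
Qed.

Canonical graph_aut_group (T : finType) (e : rel T) : {group {perm T}} :=
  Group (graph_aut_group_set e).

Lemma vertex_transitiveP (T : finType) (e : rel T) (x y : T) :
  vertex_transitive e -> exists2 g, g \in graph_aut e & g x = y.
Proof.
move=> e_vt; have [g Gg ->] := atransP2 e_vt (in_setT x) (in_setT y).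
by exists g.
Qed.

(** * Permutations and the wreath product in coordinates *)

Lemma perm_2trans (T : finType) (a b c d : T) :
  a != b -> c != d -> exists s : {perm T}, s a = c /\ s b = d.
Proof.
move=> neq_ab neq_cd; pose b' := tperm a c b.
have neq_cb' : c != b' by rewrite -(tpermL a c) (inj_eq perm_inj).
exists (tperm a c * tperm b' d)%g; rewrite !permM tpermL tpermL.
by rewrite tpermD // eq_sym.
Qed.

(** Maps made of a sign shift and an index permutation are closed under composition, so checking the
    generators is enough. *)
Lemma Ygrp_act (m : nat) (y : {perm signed m}) :
  y \in Ygrp m -> exists b (s : 'S_m), forall x, y x = (b (+) x.1, s x.2).
Proof.
case/gen_prodgP=> n [c Yc ->]; elim/big_ind: _ => [|y1 y2|i _].
- by exists false, 1%g => -[a i]; rewrite !perm1.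
- move=> [b1 [s1 E1]] [b2 [s2 E2]]; exists (b2 (+) b1), (s1 * s2)%g => x.
  by rewrite !permM E1 E2 /= addbA.
- have /setU1P[-> | /imsetP[s _ ->]] := Yc i.
    by exists true, 1%g => x; rewrite permE perm1.
  by exists false, s => x; rewrite permE.
Qed.

Lemma wreath_Ygrp_act (m k : nat) (g : {perm signed m * 'I_k}) :
  g \in wreath k (Ygrp m) ->
  exists (b : 'I_k -> bool) (s : 'I_k -> 'S_m) (h : 'S_k),
    forall eps i j, g ((eps, i), j) = ((b j (+) eps, s j i), h j).
Proof.
case/imset2P=> y h /ffun_onP Yy _ ->.
have /fin_all_exists[b /fin_all_exists[s ys]] j := Ygrp_act (Yy j).
by exists b, s, h => eps i j; rewrite permE /wr_fun /= ys.
Qed.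

(** * The four candidate block graphs *)

(* The four possible induced graphs on a block: [lam] says whether opposite   *)
(* signs are joined along equal or along distinct indices.                    *)
Definition block_graph (m : nat) (lam kap : bool) : rel (signed m) :=
  fun x y => if x.1 == y.1 then kap && (x.2 != y.2) else (x.2 == y.2) == lam.
Arguments block_graph : clear implicits.

Definition signed_pair (m : nat) (x : signed m) : 'I_m * 'I_2 :=
  (x.2, inord x.1).

Lemma signed_pair_bij (m : nat) : bijective (@signed_pair m).
Proof.
exists (fun x => (x.2 == inord 1, x.1)) => [[eps i]|[i eps]] /=.
  by case: eps; rewrite /signed_pair /= -val_eqE /= !inordK.
congr (_, _); apply: val_inj; rewrite -val_eqE /= !inordK //.
  by case: eps => -[|[|?]].
by case: (_ == _).
Qed.

Lemma signed_pairE (m : nat) (x y : signed m) :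
  ((signed_pair x).1 == (signed_pair y).1 = (x.2 == y.2)) *
  ((signed_pair x).2 == (signed_pair y).2 = (x.1 == y.1)).
Proof.
split=> //=; rewrite -val_eqE /= !inordK ?ltnS ?leq_b1 //.
by case: x.1 y.1 => -[].
Qed.

Lemma block_graph_matching (m : nat) :
  graph_iso (block_graph m true false) (@matching m).
Proof.
exists (@signed_pair m) => [|x y]; first exact: signed_pair_bij.
rewrite /matching /complete_graph !signed_pairE /block_graph eqb_id andbC.
by case: eqP.
Qed.

Lemma block_graph_prism (m : nat) :
  graph_iso (block_graph m true true) (@prism m).
Proof.
exists (@signed_pair m) => [|x y]; first exact: signed_pair_bij.
rewrite /prism /cart_prod /complete_graph !signed_pairE /block_graph eqb_id.
by do 2!case: eqP.
Qed.

Lemma graph_iso_compl (T U : finType) (e : rel T) (f : rel U) :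
  graph_iso e f -> graph_iso (compl_graph e) (compl_graph f).
Proof.
case=> phi phi_bij phi_mono; exists phi => // x y.
by rewrite /compl_graph phi_mono (inj_eq (bij_inj phi_bij)).
Qed.

(** Complementing flips [kap] inside a sign class and [lam] across; on the diagonal both sides are
    false. *)
Lemma compl_block_graph (m : nat) (lam kap : bool) :
  graph_iso (block_graph m (~~ lam) (~~ kap))
            (compl_graph (block_graph m lam kap)).
Proof.
exists id => [|[a i] [b j]]; first by exists id.
rewrite /compl_graph /block_graph xpair_eqE /=.
by case: eqP; case: eqP; case: lam; case: kap.
Qed.

Lemma block_graph_compl_matching (m : nat) :
  graph_iso (block_graph m false true) (compl_graph (@matching m)).
Proof.
apply: graph_iso_trans (compl_block_graph m true false) _.
exact: graph_iso_compl (block_graph_matching m).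
Qed.

Lemma block_graph_compl_prism (m : nat) :
  graph_iso (block_graph m false false) (compl_graph (@prism m)).
Proof.
apply: graph_iso_trans (compl_block_graph m true true) _.
exact: graph_iso_compl (block_graph_prism m).
Qed.

(** The degree is independent of [x] and serves as the isomorphism invariant: its values 1, m, m-1
    and 2(m-1) are distinct once m > 2. *)
Lemma block_graph_degree (m : nat) (lam kap : bool) (x : signed m) :
  #|block_graph m lam kap x| = kap * m.-1 + (if lam then 1 else m.-1).
Proof.
have card_neq : #|[pred i | x.2 != i]| = m.-1.
  rewrite -[X in _ = X.-1]card_ord -(cardC1 x.2).
  by apply: eq_card => i; rewrite !inE eq_sym.
rewrite -sum1_card big_mkcond /=.
rewrite -(pair_big xpredT xpredT
  (fun a i => if (a, i) \in block_graph m lam kap x then 1 else 0)) /=.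
rewrite (bigD1 x.1) //= (bigD1 (~~ x.1)) /=; last by case: x.1.
rewrite [X in _ + (_ + X)]big1 ?addn0; last by case: x.1 => -[].
congr addn; rewrite -big_mkcond sum1_card.
  case: kap; last first.
    by apply: eq_card0 => i; rewrite -!topredE /= /block_graph eqxx.
  rewrite mul1n -card_neq; apply: eq_card => i.
  by rewrite -!topredE /= /block_graph eqxx.
have E i : ((~~ x.1, i) \in block_graph m lam kap x) = ((x.2 == i) == lam).
  by rewrite -topredE /= /block_graph /=; case: x.1.
rewrite (eq_card (B := [pred i | (x.2 == i) == lam])); last exact: E.
case: lam {E}; last first.
  by rewrite -card_neq; apply: eq_card => i; rewrite !inE eqbF_neg.
by rewrite -(card1 x.2); apply: eq_card => i; rewrite !inE eqb_id eq_sym.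
Qed.

(* For [m = 2] a matching between two 2-sets and its bipartite complement     *)
(* coincide up to relabelling, so [lam] is then not an isomorphism invariant. *)
Lemma block_graph_iso_inj (m : nat) (lam kap lam' kap' : bool) :
  1 < m -> graph_iso (block_graph m lam kap) (block_graph m lam' kap') ->
  kap = kap' /\ (lam = lam' \/ m = 2).
Proof.
move=> hm /(graph_iso_degree (true, Ordinal hm))[y].
rewrite !block_graph_degree.
by case: lam; case: kap; case: lam'; case: kap' => /= E; split;
  (reflexivity || (left; reflexivity) || (right; lia) || lia).
Qed.

(** * Adjacency within and between blocks *)

Section BlockStructure.

Variables (m k : nat) (hm : 1 < m) (hk : 0 < k).
Variable e : rel (signed m * 'I_k).

Let i0 : 'I_m := Ordinal (ltnW hm).
Let i1 : 'I_m := Ordinal hm.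
Let j1 : 'I_k := Ordinal hk.

Hypotheses (e_sym : symmetric e) (e_irr : irreflexive e).
Hypothesis e_vt : vertex_transitive e.
Hypothesis Xk_sub : Xk m k \subset graph_aut e.
Hypothesis sub_wr : graph_aut e \subset wreath k (Ygrp m).
Hypothesis stabX : ('C_(graph_aut e)(~: Dset m j1 | 'P))%g
                   = base_factor (Xgrp m) j1.

(** One permutation serves both signs of a block, but different blocks are permuted
    independently. *)
Lemma Xk_mono (s : 'I_k -> 'S_m) a i j a' i' j' :
  e ((a, s j i), j) ((a', s j' i'), j') = e ((a, i), j) ((a', i'), j').
Proof.
have /(subsetP Xk_sub)/graph_autP Hs :
    wr_perm [ffun j => sym_perm (s j)] 1 \in Xk m k.
  by apply: imset_f; apply/ffun_onP=> l; rewrite ffunE; apply: imset_f.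
by rewrite -[RHS]Hs !permE /wr_fun /= !ffunE !perm1 !permE.
Qed.

Lemma cross_block_const j j' a a' i i' l l' :
  j != j' -> e ((a, i), j) ((a', i'), j') = e ((a, l), j) ((a', l'), j').
Proof.
move=> neq_jj'; pose s n := if n == j then tperm l i else tperm l' i'.
by rewrite -(Xk_mono s) /s eqxx eq_sym (negPf neq_jj') !tpermR.
Qed.

(** Inside a block only the orbit of the index pair under Sym(m) matters: the diagonal here, its
    complement in [block_const_neq] by 2-transitivity. *)
Lemma block_const_eq j a a' i :
  e ((a, i), j) ((a', i), j) = e ((a, i0), j) ((a', i0), j).
Proof. by rewrite -(Xk_mono (fun=> tperm i0 i)) !tpermR. Qed.

Lemma block_const_neq j a a' i i' : i != i' ->
  e ((a, i), j) ((a', i'), j) = e ((a, i0), j) ((a', i1), j).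
Proof.
move=> neq_ii'.
have [//|s [<- <-]] := perm_2trans (a := i0) (b := i1) _ neq_ii'.
exact: (Xk_mono (fun=> s)).
Qed.

(** * Automorphisms supported on one block *)

Definition block_perm (y : {perm signed m}) (j : 'I_k) :
    {perm signed m * 'I_k} :=
  wr_perm [ffun l => if l == j then y else 1%g] 1.

Lemma block_permE y j x : block_perm y j (x, j) = (y x, j).
Proof. by rewrite permE /wr_fun /= ffunE eqxx perm1. Qed.

Lemma block_perm_out y j x l : l != j -> block_perm y j (x, l) = (x, l).
Proof. by move/negPf=> neq; rewrite permE /wr_fun /= ffunE neq !perm1. Qed.

Lemma block_perm_aut (y : {perm signed m}) (j : 'I_k) :
  (forall x x', e (y x, j) (y x', j) = e (x, j) (x', j)) ->
  (forall x x' l, l != j -> e (y x, j) (x', l) = e (x, j) (x', l)) ->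
  block_perm y j \in graph_aut e.
Proof.
move=> y_in y_out; apply/graph_autP=> -[x l] [x' l'].
have [->|neq] := eqVneq l j; have [->|neq'] := eqVneq l' j.
- by rewrite !block_permE.
- by rewrite block_permE block_perm_out ?y_out.
- by rewrite block_permE block_perm_out // ![e (x, l) _]e_sym y_out.
- by rewrite !block_perm_out.
Qed.

(** The usable form of the stabiliser hypothesis. It is contradicted below in two ways: by a [u]
    acting differently on the two signs, and by a [u] changing signs. *)
Lemma stabilizer_sym u :
  u \in graph_aut e -> (forall x l, l != j1 -> u (x, l) = (x, l)) ->
  exists s : 'S_m, forall a i, u ((a, i), j1) = ((a, s i), j1).
Proof.
move=> Gu u_out; have : u \in base_factor (Xgrp m) j1.
  rewrite -stabX inE Gu; apply/astabP=> -[x l]; rewrite !inE /= => neq.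
  by rewrite apermE u_out.
case/imsetP=> _ /imsetP[s _ ->] ->; exists s => a i.
by rewrite -/(block_perm _ _) block_permE permE.
Qed.

(* If [A_1] were joined to [A_{-1}] completely or not at all, a transposition *)
(* of two points of [A_1] would be an automorphism outside [X].               *)
Lemma first_block_opposite :
  e ((true, i0), j1) ((false, i0), j1)
    = ~~ e ((true, i0), j1) ((false, i1), j1).
Proof.
set a := LHS; set b := e _ _.
have [eq_ab|] := eqVneq a b; last by case: a; case: b.
have opp i i' : e ((true, i), j1) ((false, i'), j1) = a.
  have [->|neq] := eqVneq i i'; first exact: block_const_eq.
  by rewrite eq_ab; apply: block_const_neq.
pose f (x : signed m) := if x.1 then (true, tperm i0 i1 x.2) else x.
have f_inj : injective f.
  move=> [[] i] [[] i']; rewrite /f /= => -[] // E; congr (_, _);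
    first [exact: perm_inj E | exact: E].
have [||s s_stab] := @stabilizer_sym (block_perm (perm f_inj) j1).
- apply: block_perm_aut => [x x'|x x' l neq]; rewrite !permE.
    case: x x' => -[] i [] [] i'; rewrite /f //=.
    (* On two positive points the map agrees with an element of X^k. *)
    + exact: (Xk_mono (fun=> tperm i0 i1)).
    + by rewrite !opp.
    + by rewrite ![e ((false, _), _) _]e_sym !opp.
  case: x x' => -[] i [a' i']; rewrite /f //=.
  by apply: cross_block_const; rewrite eq_sym.
- by move=> x l neq; rewrite block_perm_out.
(* The positive points force [s i0 = i1], the negative ones [s i0 = i0]. *)
have := s_stab true i0; have := s_stab false i0.
by rewrite !block_permE !permE /f /= tpermL => -[<-] -[].
Qed.

(** The stabiliser is known for the first block only; [g] transports statements between that block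
    and block [j]. *)
Lemma block_move j : exists g (b : 'I_k -> bool) (s : 'I_k -> 'S_m) (h : 'S_k),
  [/\ g \in graph_aut e, h j1 = j
    & forall a i l, g ((a, i), l) = ((b l (+) a, s l i), h l)].
Proof.
have [g Gg g_j] := vertex_transitiveP ((true, i0), j1) ((true, i0), j) e_vt.
have [b [s [h gE]]] := wreath_Ygrp_act (subsetP sub_wr g Gg).
exists g, b, s, h; split=> //.
by move: g_j; rewrite gE => -[].
Qed.

(** An automorphism taking a positive point of the first block to its negative lies in the wreath
    product, hence maps all of A_1 onto A_{-1}. *)
Lemma first_block_sign :
  e ((false, i0), j1) ((false, i1), j1) = e ((true, i0), j1) ((true, i1), j1).
Proof.
have [g Gg g_neg] :=
  vertex_transitiveP ((true, i0), j1) ((false, i0), j1) e_vt.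
have [b [s [h gE]]] := wreath_Ygrp_act (subsetP sub_wr g Gg).
move: g_neg; rewrite gE => -[b_j1 _ h_j1].
have b_true : b j1 by move: b_j1; case: (b j1).
move/graph_autP: Gg => <-; rewrite !gE b_true h_j1 /=.
by apply: block_const_neq; rewrite (inj_eq perm_inj).
Qed.

Definition uniform_blocks (lam kap : bool) :=
  forall j x x', e (x, j) (x', j) = block_graph m lam kap x x'.

Lemma uniform_blocks_exist : exists lam kap, uniform_blocks lam kap.
Proof.
pose lam := e ((true, i0), j1) ((false, i0), j1).
pose kap := e ((true, i0), j1) ((true, i1), j1).
exists lam, kap.
have first x x' : e (x, j1) (x', j1) = block_graph m lam kap x x'.
  have opp i i' : e ((true, i), j1) ((false, i'), j1) = ((i == i') == lam).
    have [->|neq] := eqVneq i i'; first exact: block_const_eq.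
    by rewrite block_const_neq // /lam first_block_opposite; case: (e _ _).
  case: x x' => [a i] [a' i']; rewrite /block_graph /=.
  have [<-|neq_a] := eqVneq a a'.
    have [->|neq] := eqVneq i i'; first by rewrite e_irr andbF.
    rewrite block_const_neq // andbT; case: a => //.
    exact: first_block_sign.
  by case: a a' neq_a => -[] // _; rewrite ?opp // e_sym opp [i' == i]eq_sym.
move=> j [a i] [a' i'].
have [g [b [s [h [/graph_autP Gg h_j1 gE]]]]] := block_move j.
(* Both endpoints are pulled back by the same sign shift and index permutation, and [block_graph]
   only compares signs and indices for equality. *)
have gK c l : ((c, l), j) = g ((b j1 (+) c, (s j1)^-1%g l), j1).
  by rewrite gE addKb permKV h_j1.
rewrite !gK Gg first /block_graph /= !(inj_eq perm_inj).
by rewrite (inj_eq (can_inj (addKb _))).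
Qed.

(** * The quotient graph and the isomorphism with Inf *)

Section Uniform.

Variables lam kap : bool.
Hypothesis unif : uniform_blocks lam kap.

Lemma induced_block_iso j :
  graph_iso (@induced _ e (Dset m j)) (block_graph m lam kap).
Proof.
have Dj x : (x, j) \in Dset m j by rewrite inE.
exists (fun u => (val u).1).
  exists (fun x => exist _ (x, j) (Dj x)) => // u.
  by apply: val_inj => /=; case: u => -[x l] /=; rewrite inE => /= /eqP->.
move=> u v; have [] := (valP u, valP v); rewrite !inE => /eqP Eu /eqP Ev.
rewrite /induced [val u]surjective_pairing [val v]surjective_pairing.
by rewrite Eu Ev unif.
Qed.

Lemma mem_Aset a (x : signed m * 'I_k) j :
  (x \in Aset m a j) = (x.1.1 == a) && (x.2 == j).
Proof.
case: x => [[a' i] j'] /=; apply/imsetP/andP; last first.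
  by case=> /eqP-> /eqP->; exists i.
by case=> l _ [-> _ ->]; rewrite !eqxx.
Qed.

(** Between distinct blocks one edge forces all, so any two representatives decide adjacency of the
    orbits. *)
Lemma quotient_graphE a j a' j' i i' : j != j' ->
  quotient_graph e (Avertex hm a j) (Avertex hm a' j')
    = e ((a, i), j) ((a', i'), j').
Proof.
move=> neq; rewrite /quotient_graph.
have -> : Avertex hm a j != Avertex hm a' j'.
  by apply: contraNneq neq => /Avertex_inj[_ ->].
apply/existsP/idP=> [[x /andP[Ax /existsP[x' /andP[Ax' exx']]]]|exx'].
  move: Ax Ax' exx'; rewrite !mem_Aset; case: x x' => [[b l] n] [[b' l'] n'] /=.
  move=> /andP[/eqP-> /eqP->] /andP[/eqP-> /eqP->].
  by rewrite (cross_block_const _ _ _ _ i i').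
exists ((a, i), j); rewrite mem_Aset /= !eqxx /=; apply/existsP.
by exists ((a', i'), j'); rewrite mem_Aset /= !eqxx.
Qed.

Lemma Avertex_eq a j a' j' :
  (Avertex hm a j == Avertex hm a' j' :> quotient_vertex (Xk m k))
    = (a == a') && (j == j').
Proof.
apply/eqP/andP=> [/Avertex_inj[-> ->]|[/eqP-> /eqP->]] //.
Qed.

Lemma Avertex_surj (A : quotient_vertex (Xk m k)) :
  exists a j, A = Avertex hm a j.
Proof.
have /imsetP[[a j] _ A_aj] :
    val A \in [set Aset m ej.1 ej.2 | ej : bool * 'I_k].
  by rewrite -(orbits_Xk k hm); exact: valP.
by exists a, j; apply: val_inj.
Qed.

Lemma Ppart_pair a j a' j' :
  ([set Avertex hm a j; Avertex hm a' j'] \in Ppart k hm)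
    = (j == j') && (a != a').
Proof.
apply/imsetP/andP=> [[l _ /setP eqP_l]|[/eqP<- neq]].
  move: (eqP_l (Avertex hm true l)) (eqP_l (Avertex hm false l)).
  rewrite !inE !Avertex_eq !eqxx /= {eqP_l}.
  by case: (a); case: (a'); rewrite ?(eq_sym l) //= ?orbF => /eqP-> /eqP->.
exists j => //; case: a a' neq => -[] // _; exact: setUC.
Qed.

(* [s] relabels the negative points so as to turn [lam] into [lam']: the      *)
(* identity if [lam = lam'], the transposition if [m = 2].                    *)
Lemma inf_graph_iso (s : 'S_m) (lam' : bool) :
  (forall i i', ((i == s i') == lam') = ((i == i') == lam)) ->
  graph_iso e (inf_graph (@quotient_graph _ e (Xk m k)) (Ppart k hm) (m := m)
    (if lam' then 1%R else 0%R) (if kap then 1%R else 0%R)).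
Proof.
move=> s_lam.
pose phi (x : signed m * 'I_k) : quotient_vertex (Xk m k) * 'I_m :=
  (Avertex hm x.1.1 x.2, if x.1.1 then x.1.2 else s x.1.2).
exists phi.
  have phi_inj : injective phi.
    move=> [[a i] j] [[a' i'] j'] E.
    have /Avertex_inj[/= eq_a ->] := congr1 fst E.
    move: (congr1 snd E); rewrite /= -eq_a.
    by case: (a) => [->|/perm_inj->].
  apply: inj_card_bij phi_inj _.
  rewrite !card_prod !card_ord -mulnA [m * k]mulnC mulnA leq_mul2r.
  apply/orP; right.
  (* The quotient has at most 2k vertices because [f] is onto; with injectivity of [phi] this gives
     bijectivity. *)
  pose f (x : bool * 'I_k) := Avertex hm x.1 x.2.
  have <- : #|{: bool * 'I_k}| = #|{: bool}| * k by rewrite card_prod card_ord.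
  rewrite -(card_codom (f := f)); last first.
    by move=> [a j] [a' j'] /Avertex_inj.
  apply/subset_leq_card/subsetP=> A _.
  by have [a [j ->]] := Avertex_surj A; apply: (codom_f f (a, j)).
move=> [[a i] j] [[a' i'] j']; rewrite /phi /inf_graph /= Ppart_pair Avertex_eq.
have [<-|neq] := eqVneq j j'; last first.
  by rewrite andbF /= orbF (quotient_graphE _ _ i i').
rewrite unif /block_graph /= andbT.
have lamE : (((if lam' then 1 else 0) == 1 :> 'Z_2)%R = lam') *
    (((if lam' then 1 else 0) == 0 :> 'Z_2)%R = ~~ lam').
  by case: (lam').
have kapE : ((if kap then 1 else 0) == 1 :> 'Z_2)%R = kap by case: (kap).
rewrite !lamE kapE.
have lam_pm l l' : lam' && (l == l') || ~~ lam' && (l != l')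
    = ((l == l') == lam') by case: lam' {s_lam lamE}; case: eqP.
have [<-|neq] := eqVneq a a'; rewrite /= ?orbF.
  (* The quotient graph has no loops, so for equal signs only the [kap] clause survives. *)
  rewrite /quotient_graph eqxx [RHS]andbC.
  by case: (a); rewrite ?(inj_eq perm_inj).
rewrite lam_pm; case: a a' neq => -[] // _.
by rewrite [s i == i']eq_sym s_lam [i' == i]eq_sym.
Qed.

End Uniform.

(** * Transpositions of the quotient graph *)

Lemma swap_signs_notin_aut j : block_perm (tau m) j \notin graph_aut e.
Proof.
apply/negP=> Gtau; have [g [b [s [h [Gg h_j1 gE]]]]] := block_move j.
(* Products act from left to right: the conjugate moves the first block to block [j], changes signs
   there and returns. *)
have [||t tE] := @stabilizer_sym (g * block_perm (tau m) j * g^-1)%g.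
- by rewrite groupM ?groupV // groupM.
- move=> [a i] l neq; rewrite !permM gE block_perm_out -?gE ?permK //.
  by rewrite -h_j1 (inj_eq perm_inj).
have := tE true i0; rewrite !permM => /(canRL (permKV g)).
by rewrite !gE h_j1 block_permE permE /neg_fun /= => -[]; case: (b j1).
Qed.

(** The sign change on block [j] always preserves the edges inside it; the edges leaving it are read
    off the quotient, where it induces the transposition. *)
Lemma quotient_tperm_notin_aut j :
  tperm (Avertex hm true j) (Avertex hm false j)
    \notin graph_aut (@quotient_graph _ e (Xk m k)).
Proof.
apply: contra (swap_signs_notin_aut j) => /graph_autP Gt.
have [lam [kap unif]] := uniform_blocks_exist.
apply: block_perm_aut => [x x'|[a i] [a' i'] l neq]; rewrite !permE.
  rewrite !unif /block_graph /neg_fun /=.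
  by case: x.1 x'.1 => -[].
have neq' : j != l by rewrite eq_sym.
rewrite -!(quotient_graphE _ _ _ _ neq') -[RHS]Gt.
rewrite [X in _ = quotient_graph _ _ X]tpermD; last 2 first.
- by rewrite Avertex_eq (negPf neq') andbF.
- by rewrite Avertex_eq (negPf neq') andbF.
by case: (a); rewrite ?tpermL ?tpermR.
Qed.

(** If [A] and [B] came from different blocks, the transposition would send the pair of [A] and its
    opposite to one straddling two blocks. *)
Lemma Ppart_tperm (A B : quotient_vertex (Xk m k)) :
  A != B -> [set tperm A B @: p | p : {set _} in Ppart k hm] = Ppart k hm ->
  [set A; B] \in Ppart k hm.
Proof.
have [a [j ->]] := Avertex_surj A; have [a' [j' ->]] := Avertex_surj B.
rewrite Avertex_eq Ppart_pair negb_and => neq tperm_P.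
have [eq_j|neq_j] := eqVneq j j'; first by move: neq; rewrite eq_j eqxx orbF.
have : tperm (Avertex hm a j) (Avertex hm a' j') @:
    [set Avertex hm a j; Avertex hm (~~ a) j] \in Ppart k hm.
  by rewrite -tperm_P imset_f // Ppart_pair eqxx; case: (a).
rewrite imsetU1 imset_set1 tpermL tpermD ?Ppart_pair ?Avertex_eq.
- by rewrite eq_sym (negPf neq_j).
- by rewrite eqxx andbT; case: (a).
- by rewrite [j' == j]eq_sym (negPf neq_j) andbF.
Qed.

End BlockStructure.

(** * Assembly of the three claims *)

Theorem theorem3p14 (m k : nat) (hm : 1 < m) (hk : 0 < k)
  (e : rel (signed m * 'I_k))
  (e_sym : symmetric e) (e_irr : irreflexive e)
  (e_vt : vertex_transitive e)
  (Xk_sub : Xk m k \subset graph_aut e)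
  (sub_wr : graph_aut e \subset wreath k (Ygrp m))
  (stabX : ('C_(graph_aut e)(~: Dset m (Ordinal hk) | 'P))%g
           = base_factor (Xgrp m) (Ordinal hk)) :
  let Sigma := @quotient_graph _ e (Xk m k) in
  let P := Ppart k hm in
  let GD := fun j : 'I_k => @induced _ e (Dset m j) in
  let GD1 := GD (Ordinal hk) in
  [/\ (* (1) *)
      forall j1 j2 : 'I_k,
        graph_iso (GD j1) (GD j2) /\
        [\/ graph_iso (GD j1) (@matching m),
            graph_iso (GD j1) (@prism m),
            graph_iso (GD j1) (compl_graph (@matching m))
          | graph_iso (GD j1) (compl_graph (@prism m))],
      (* (2) *)
      [/\ graph_iso GD1 (@matching m) ->
            graph_iso e (@inf_graph _ Sigma P m 1%R 0%R),
          graph_iso GD1 (@prism m) ->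
            graph_iso e (@inf_graph _ Sigma P m 1%R 1%R),
          graph_iso GD1 (compl_graph (@matching m)) ->
            graph_iso e (@inf_graph _ Sigma P m 0%R 1%R)
        & graph_iso GD1 (compl_graph (@prism m)) ->
            graph_iso e (@inf_graph _ Sigma P m 0%R 0%R)]
    & (* (3) *)
      (forall j : 'I_k,
         tperm (Avertex hm true j) (Avertex hm false j) \notin graph_aut Sigma) /\
      ~ (exists A B : quotient_vertex (Xk m k),
           [/\ A != B, tperm A B \in graph_aut Sigma
             & [set tperm A B @: p | p : {set _} in P] = P])].

Proof.
move=> Sigma P GD GD1.
have [lam [kap unif]] :=
  uniform_blocks_exist hm e_sym e_irr e_vt Xk_sub sub_wr stabX.
have GD_iso j : graph_iso (GD j) (block_graph m lam kap).
  exact: induced_block_iso.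
have e_iso lam' kap' (U : finType) (f : rel U) :
    graph_iso (block_graph m lam' kap') f -> graph_iso GD1 f ->
    graph_iso e (@inf_graph _ Sigma P m (if lam' then 1%R else 0%R)
                                        (if kap' then 1%R else 0%R)).
  move=> blk_f GD1_f.
  have blk_iso : graph_iso (block_graph m lam kap) (block_graph m lam' kap').
    apply: graph_iso_trans (graph_iso_sym (GD_iso (Ordinal hk))) _.
    exact: graph_iso_trans GD1_f (graph_iso_sym blk_f).
  have [<- lam_lam'] := block_graph_iso_inj hm blk_iso.
  (* [kap] is determined, but for m = 2 [lam'] may differ from [lam]; [s] absorbs the difference. *)
  suff [s s_lam] : exists s : 'S_m,
      forall i i', ((i == s i') == lam') = ((i == i') == lam).
    exact: (inf_graph_iso hm Xk_sub unif s_lam).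
  have [<-|neq_lam] := eqVneq lam lam'.
    by exists 1%g => i i'; rewrite perm1.
  case: lam_lam' => [eq_lam|m2]; first by rewrite eq_lam eqxx in neq_lam.
  (* With two indices, swapping one side exchanges equality and inequality. *)
  exists (tperm (Ordinal (ltnW hm)) (Ordinal hm)) => i i'.
  have -> : (i == tperm (Ordinal (ltnW hm)) (Ordinal hm) i') = (i != i').
    have lt_i := ltn_ord i; have lt_i' := ltn_ord i'.
    by case: tpermP => [->|->|/eqP + /eqP +]; rewrite -!val_eqE /=; lia.
  by case: (i == i'); case: (lam) neq_lam; case: (lam').
split.
- move=> j1 j2; split.
    exact: graph_iso_trans (GD_iso j1) (graph_iso_sym (GD_iso j2)).
  have := graph_iso_trans (GD_iso j1).
  case: (lam) (kap) => -[] iso_blk.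
  + exact/Or42/iso_blk/block_graph_prism.
  + exact/Or41/iso_blk/block_graph_matching.
  + exact/Or43/iso_blk/block_graph_compl_matching.
  + exact/Or44/iso_blk/block_graph_compl_prism.
- split.
  + exact: (e_iso true false) (block_graph_matching m).
  + exact: (e_iso true true) (block_graph_prism m).
  + exact: (e_iso false true) (block_graph_compl_matching m).
  + exact: (e_iso false false) (block_graph_compl_prism m).
have no_tperm j : tperm (Avertex hm true j) (Avertex hm false j)
    \notin graph_aut Sigma.
  exact: (quotient_tperm_notin_aut hm e_sym e_irr e_vt Xk_sub sub_wr stabX).
(* Now [A] and [B] form a pair of the partition, so up to order the transposition is one already
   excluded. *)
split=> // -[A [B [neq_AB Gt /(Ppart_tperm neq_AB)]]].
case/imsetP=> j _ /setP eq_AB.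
have := eq_AB A; have := eq_AB B; rewrite !inE !eqxx /= orbT.
move=> /esym/orP EB /esym/orP EA; case/negP: (no_tperm j).
case: EA neq_AB Gt => /eqP->; case: EB => /eqP->; rewrite ?eqxx // => _.
by rewrite tpermC.
Qed.
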